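(* Let $G$ be a finite group. Then $G$ is nilpotent of class at most $2$ if and only if there exists an element $x \in G$ such that $[u_1,u_2,u_3]=1$ for every $u_1,u_2,u_3 \in \mathrm{Sol}_G(x)$.
   Context: For a finite group $G$ and $x \in G$, the solubilizer of $x$ in $G$ is the subset $\mathrm{Sol}_G(x)=\{y \in G \mid \langle x,y\rangle \text{ is soluble}\}$ (not a subgroup in general). Long commutators: $[x_1,x_2]=x_1^{-1}x_2^{-1}x_1x_2$ and $[x_1,x_2,x_3]=[[x_1,x_2],x_3]$. *)

(* Defs.v *)
From mathcomp Require Import all_boot all_fingroup all_solvable.

Set Implicit Arguments.
Unset Strict Implicit.
Unset Printing Implicit Defensive.

Import GroupScope.

Definition solubilizer (gT : finGroupType) (G : {set gT}) (x : gT) : {set gT} :=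
  [set y in G | solvable <<[set x; y]>>].

(* Main.v *)
(* Put S = Sol_G(x). The commutator condition makes <S> of class at most 2, so
   it suffices to show G = <S>. If not, <S> lies in a maximal subgroup M, of
   class at most 2 by induction on |G|; then G is soluble by Deskins' theorem
   below, and S = G.

   Deskins: let H be a maximal subgroup of class at most 2 of a minimal
   insoluble G, so that N_G(A) = H for every soluble A != 1 normalised by H.
   If P is a Sylow p-subgroup of H, then P is Sylow in G and Z(P) is weakly
   closed in P: when Z(P) <= P^h, the class condition makes <Z(P), Z(P)^h>
   normal in both P and P^h. Hence P controls its own fusion, and two
   applications of the focal subgroup theorem show that G'' is a p'-group.
   A minimal normal subgroup L of G is perfect, hence inside G'' and of order
   coprime to |H|. So H normalises some nontrivial Sylow subgroup of L, which
   must then lie in H: a contradiction. *)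
Require Import Defs.
From mathcomp Require Import all_boot all_fingroup all_solvable.
From mathcomp Require Import ssralg finalg.
Import GroupScope.

(** * Transfer and control of fusion *)

(** The transfer from G to P / P' kills G', its target being abelian. On P it is the power map of
    exponent [#|G : P|] modulo P', and this exponent is prime to p, so only elements of P' are
    killed. *)
Lemma Sylow_control_focal (gT : finGroupType) (p : nat) (G P : {group gT}) :
    p.-Sylow(G) P ->
    (forall a g, a \in P -> g \in G -> a ^ g \in P ->
       exists2 u, u \in P & a ^ g = a ^ u) ->
  P :&: G^`(1) \subset P^`(1).
Proof.
move=> sylP fusP; have [sPG pP p'PG] := and3P sylP.
have nPP' : P \subset 'N(P^`(1)) := der_norm 1 P.
pose alpha := restrm_morphism nPP' (coset_morphism P^`(1)).
have abA: abelian (alpha @* P).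
  by rewrite morphim_restrm setIid -quotientE sub_der1_abelian.
(* [fa] is [alpha] with its abelian image written additively, as in the expansion of the
   transfer. *)
pose fa := restrm_morphism (transfer_morph_subproof alpha)
  (comp_morphism alpha (FiniteModule.fmod_morphism abA)).
have faJ a u: a \in P -> u \in P -> fa (a ^ u) = fa a.
  move=> Pa Pu; rewrite morphJ // conjgE.
  by rewrite (FinRing.Theory.zmod_mulgC (fa a)) mulKg.
pose V := transfer_morphism G abA.
apply/subsetP=> g /setIP[Pg G'g]; have Gg := subsetP sPG g Pg.
have Vg1: V g = 1.
  have V1: V @* G^`(1) \subset [set 1].
    rewrite morphim_der //; rewrite -set1gE; apply/trivgP; apply/derG1P.
    exact: FinRing.Theory.zmod_abelian.
  by apply/set1P; rewrite (subsetP V1) ?mem_morphim.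
(* Every factor of the transfer of g is P-conjugate to a power of g, so that
   V g = (g P') ^+ #|G : P| in P / P'. *)
have trX := transversalP (rcosets_cycle_partition sPG Gg).
have Vg: V g = fa g ^+ #|G : P|.
  rewrite [LHS](transfer_cycle_expansion sPG abA Gg trX).
  rewrite -(sum_index_rcosets_cycle sPG Gg trX) FinRing.Theory.zmodXgE.
  rewrite -GRing.sumrMnr.
  apply: eq_bigr => x Xx; rewrite -FinRing.Theory.zmodXgE -morphX //.
  set n := #|_ : _|.
  have Gx : x^-1 \in G by rewrite groupV (subsetP (transversal_sub trX)).
  have Pgx : (g ^+ n) ^ x^-1 \in P.
    rewrite conjgE invgK mulgA -mem_rcoset; exact: mulg_exp_card_rcosets.
  have [u Pu eq_gu] := fusP _ _ (groupX n Pg) Gx Pgx.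
  by rewrite eq_gu faJ ?groupX.
have ag1: coset P^`(1) g ^+ #|G : P| = 1.
  have:= Vg1; rewrite Vg => /(congr1 val).
  rewrite FinRing.Theory.zmodXgE FiniteModule.fmvalZ FiniteModule.fmodK //.
  exact: mem_morphim.
rewrite coset_idr ?(subsetP nPP') //; apply/eqP.
rewrite -order_eq1; apply/eqP/(@pnat_1 p).
  exact: mem_p_elt (quotient_pgroup _ pP) (mem_quotient _ Pg).
by rewrite (pnat_dvd _ p'PG) // order_dvdn ag1.
Qed.

(** Burnside's argument: ['Z(P)] and ['Z(P) :^ g] both centralise [a ^ g], so some c in C moves the
    second into a Sylow subgroup S of C containing the first. The hypothesis on ['Z(P)] gives S <=
    P, and then that [g * c] normalises P. *)
Lemma weakly_closed_center_fusion (gT : finGroupType) (p : nat)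
    (G P : {group gT}) (a g : gT) :
    p.-Sylow(G) P ->
    (forall h, h \in G -> 'Z(P) \subset P :^ h -> h \in 'N(P)) ->
    a \in P -> g \in G -> a ^ g \in P ->
  exists2 n, n \in 'N_G(P) & a ^ g = a ^ n.
Proof.
move=> sylP wclZ Pa Gg Pag; have [sPG pP _] := and3P sylP.
have pZ : p.-group 'Z(P) := pgroupS (center_sub P) pP.
pose C := 'C_G[a ^ g].
have sZC : 'Z(P) \subset C.
  rewrite subsetI (subset_trans (center_sub P)) //= sub_cent1.
  by rewrite (subsetP _ _ Pag) // centsC subsetIr.
have sZgC : 'Z(P) :^ g \subset C.
  rewrite subsetI -{1}(conjGid Gg) conjSg (subset_trans (center_sub P)) //=.
  by rewrite cent1J conjSg sub_cent1 (subsetP _ _ Pa) // centsC subsetIr.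
have [S sylS sZS] := Sylow_superset sZC pZ.
have [sSC pS _] := and3P sylS.
have [c Cc sZgcS] := Sylow_Jsub sylS sZgC (etrans (pgroupJ _ _ _) pZ).
have [Gc /cent1P cc] := setIP Cc.
have [k Gk sSPk] := Sylow_subJ sylP (subset_trans sSC (subsetIl _ _)) pS.
have /normP nPk := wclZ k Gk (subset_trans sZS sSPk).
exists (g * c); last by rewrite conjgM [RHS]conjgE -cc mulKg.
rewrite inE groupM //= -groupV wclZ ?groupV ?groupM //.
by rewrite -sub_conjg conjsgM (subset_trans sZgcS) // -nPk.
Qed.

(** The focal subgroup Q = P :&: G' lies in P', hence in ['Z(P)]. Fusion of Q in G' is then trivial,
    so a second application puts Q :&: G'' inside Q' = 1. *)
Lemma class2_control_der2_p'group (gT : finGroupType) (p : nat)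
    (G P : {group gT}) :
    p.-Sylow(G) P -> P^`(1) \subset 'Z(P) ->
    (forall a g, a \in P -> g \in G -> a ^ g \in P ->
       exists2 u, u \in P & a ^ g = a ^ u) ->
  p^'.-group G^`(2).
Proof.
move=> sylP sP'Z fusP; have sG'G : G^`(1) \subset G := der_sub 1 G.
have sylQ : p.-Sylow(G^`(1)) (P :&: G^`(1)).
  exact: Hall_setI_normal (der_normal 1 G) sylP.
have sQZ : P :&: G^`(1) \subset 'Z(P).
  exact: subset_trans (Sylow_control_focal _ _ _ _ sylP fusP) sP'Z.
have sylR : p.-Sylow(G^`(2)) ((P :&: G^`(1)) :&: G^`(2)).
  exact: Hall_setI_normal (der_normal 1 _) sylQ.
have fusQ a g : a \in P :&: G^`(1) -> g \in G^`(1) -> a ^ g \in P :&: G^`(1) ->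
    exists2 u, u \in P :&: G^`(1) & a ^ g = a ^ u.
  move=> Qa G'g /setIP[Pag _]; have /setIP[Pa _] := Qa.
  have [u Pu ->] := fusP a g Pa (subsetP sG'G g G'g) Pag.
  exists 1; rewrite ?group1 // conjg1 conjgE.
  have /setIP[_ /centP/(_ u Pu) ->] := subsetP sQZ a Qa.
  by rewrite mulKg.
have := Sylow_control_focal _ _ _ _ sylQ fusQ.
rewrite /= (derG1P (abelianS sQZ (center_abelian P))) => /trivgP R1.
by rewrite /pgroup -partn_eq1 // -(card_Hall sylR) R1 cards1.
Qed.

(** * Soluble groups from maximal subgroups of class at most 2 *)

Lemma maximal_class2_solvable (gT : finGroupType) (G H : {group gT}) :
  maximal H G -> nil_class H <= 2 -> solvable G.
Proof.
have [n] := ubnP #|G|; elim: n gT G H => // n IHn gT G H /ltnSE leGn maxH clH.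
(* On a non-nilpotent group [nil_class] defaults to the order, which is at least 6; the bound 2 thus
   forces nilpotency. *)
have nilH : nilpotent H by apply: small_nil_class; apply: leq_trans clH _.
have sH'Z : H^`(1) \subset 'Z(H) by rewrite -nil_class2.
have solH := nilpotent_sol nilH.
have [prHG maxHG] := maxgroupP maxH; have sHG := proper_sub prHG.
have overH (K : {group gT}) : H \subset K -> K \subset G -> K :=: H \/ K :=: G.
  move=> sHK; rewrite subEproper => /predU1P[-> | prKG]; [by right | left].
  exact: maxHG.
apply/idPn=> nsolG.
(* Either N <= H and induction applies to G / N, or HN = G and G / N is an image of H. *)
have no_solv_normal (N : {group gT}) : N <| G -> solvable N -> N :=: 1.
  move=> nsNG solN; apply/eqP/idPn=> ntN; case/negP: nsolG.
  rewrite (series_sol nsNG) solN /=; have [sNG nNG] := andP nsNG.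
  have [] := overH (H <*> N)%G (joing_subl _ _); first by rewrite join_subG sHG.
    move=> defH; have sNH : N \subset H by rewrite -defH joing_subr.
    apply: (IHn _ _ (H / N)%G).
    - exact: leq_trans (ltn_quotient ntN sNG) leGn.
    - by rewrite quotient_maximal // (normalS sNH sHG).
    - exact: leq_trans (nil_class_morphim _ nilH) clH.
  by move=> <-; rewrite quotientYidr ?(subset_trans sHG) // quotient_sol.
have normH (A : {group gT}) : solvable A -> A :!=: 1 -> A \subset G -> H \subset 'N(A) ->
    'N_G(A) = H.
  move=> solA ntA sAG nAH.
  have [] := overH 'N_G(A)%G; rewrite ?subsetI ?sHG ?subsetIl //= => defG.
  case/eqP: ntA; apply: no_solv_normal => //.
  by rewrite -defG /= normalSG.
have pi'G2 p : p \in \pi(H) -> p^'.-group G^`(2).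
  rewrite /= mem_primes => /and3P[p_pr _ pH].
  pose P := 'O_p(H)%G; have sylPH : p.-Sylow(H) P := nilpotent_pcore_Hall p nilH.
  have pP : p.-group P := pcore_pgroup p H.
  have sPH : P \subset H := pcore_sub p H; have sPG := subset_trans sPH sHG.
  have ntP : P :!=: 1.
    apply/eqP=> P1; have /esym/eqP := card_Hall sylPH.
    by rewrite P1 cards1 partn_eq1 // p'natE ?pH.
  have ntZ : 'Z(P) != 1.
    by apply: contraNneq ntP => /(trivg_center_pgroup pP) ->.
  have sZP := center_sub P.
  have sP'Z : P^`(1) \subset 'Z(P).
    rewrite subsetI der_sub (subset_trans (dergS 1 sPH)) //.
    exact: subset_trans sH'Z (subset_trans (subsetIr _ _) (centS sPH)).
  have [_ defH cPO _] := dprodP (nilpotent_pcoreC p nilH).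
  (* H is P times its p'-core, which centralises P. *)
  have nBH (B : {group gT}) : B <| P -> H \subset 'N(B).
    case/andP=> sBP nBP; rewrite -defH mul_subG //.
    by rewrite (subset_trans _ (cent_sub B)) // (subset_trans cPO) ?centS.
  have sol_p (B : {group gT}) : B \subset P -> solvable B.
    by move=> sBP; rewrite (solvableS (subset_trans sBP sPH)).
  have sub_HP (B : {group gT}) : p.-group B -> B \subset H -> B \subset P.
    by move=> pB sBH; rewrite (sub_Hall_pcore sylPH).
  have NP : 'N_G(P) = H by rewrite normH ?nBH ?sol_p.
  have sylP : p.-Sylow(G) P by rewrite -Sylow_subnorm NP.
  have NZ : 'N_G('Z(P)) = H.
    rewrite (normH 'Z(P)%G) ?nBH ?center_normal ?sol_p //.
    exact: subset_trans sPG.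
  apply: (class2_control_der2_p'group _ _ _ _ sylP sP'Z) => a g Pa Gg Pag.
  have wclZ h : h \in G -> 'Z(P) \subset P :^ h -> h \in 'N(P).
    move=> Gh sZPh; pose A := ('Z(P) <*> 'Z(P) :^ h)%G.
    have sZhPh : 'Z(P) :^ h \subset P :^ h by rewrite conjSg.
    (* As ['Z(P)] lies in [P :^ h], it is centralised by ['Z(P) :^ h], which therefore lies in
       ['N_G('Z(P))], that is in H. *)
    have sZhP : 'Z(P) :^ h \subset P.
      rewrite (sub_HP ('Z(P) :^ h)%G) ?pgroupJ ?(pgroupS sZP) // -NZ subsetI.
      rewrite -{1}(conjGid Gh) conjSg (subset_trans sZP) //=.
      rewrite (subset_trans _ (cent_sub _)) // centsC (subset_trans sZPh) //.
      by rewrite centJ conjSg centsC subsetIr.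
    (* A contains both P' and its conjugate by h, so P and [P :^ h] normalise it. *)
    have nsAP : A <| P.
      by rewrite sub_der1_normal ?join_subG ?sZP // (subset_trans sP'Z) ?joing_subl.
    have nAPh : P :^ h \subset 'N(A).
      rewrite sub_der1_norm ?join_subG ?sZPh //.
      by rewrite derJ (subset_trans _ (joing_subr _ _)) // conjSg.
    have NA : 'N_G(A) = H.
      rewrite normH ?nBH ?sol_p ?(normal_sub nsAP) //.
        by apply: contraNneq ntZ => A1; rewrite -subG1 -A1 joing_subl.
      exact: subset_trans (normal_sub nsAP) sPG.
    have sPhP : P :^ h \subset P.
      rewrite (sub_HP (P :^ h)%G) ?pgroupJ // -NA subsetI nAPh.
      by rewrite -{1}(conjGid Gh) conjSg sPG.
    by rewrite inE.
  have [m] := weakly_closed_center_fusion _ _ _ _ _ _ sylP wclZ Pa Gg Pag.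
  (* Only u matters: v lies in the p'-core of H and centralises P. *)
  rewrite NP -defH => /mulsgP[u v Pu Ov ->] ->.
  exists u => //; rewrite conjgM [LHS]conjgE.
  have Pau : a ^ u \in P by rewrite groupJ.
  by have /centP/(_ _ Pau) <- := subsetP cPO v Ov; rewrite mulKg.
have ntG : G :!=: 1 by apply: contraNneq nsolG => ->; apply: solvable1.
have [L minL sLG] := minnormal_exists ntG (normG G).
have [/andP[ntL nLG] minL'] := mingroupP minL.
have nsLG : L <| G by apply/andP.
have nsolL : ~~ solvable L.
  by apply: contra ntL => solL; rewrite (no_solv_normal L).
have defL : L^`(1) = L.
  apply: (minL' L^`(1)%G); last exact: der_sub.
  rewrite (char_norm_trans (der_char 1 L)) // andbT.
  by apply: contra nsolL => /eqP/derG1P/abelian_sol.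
have sLG2 : L \subset G^`(2).
  by rewrite -defL -[X in X^`(1)]defL; apply: (dergS 2).
have coLH : coprime #|L| #|H|.
  rewrite coprime_sym coprime_pi' //; apply/pgroupP=> q q_pr qL.
  apply/negP=> piHq; have /pgroupP/(_ q q_pr qL) := pgroupS sLG2 (pi'G2 q piHq).
  by rewrite !inE eqxx.
have nLH := subset_trans sHG nLG.
have [Q sylQ nQH] := sol_coprime_Sylow_exists (pdiv #|L|) solH nLH coLH.
have [sQL qQ _] := and3P sylQ.
have ntQ : Q :!=: 1.
  apply/eqP=> Q1; have /esym/eqP := card_Hall sylQ.
  by rewrite Q1 cards1 partn_eq1 // p'natE ?pdiv_dvd // pdiv_prime // cardG_gt1.
have sQG := subset_trans sQL sLG.
have sQH : Q \subset H.
  by rewrite -(normH Q (pgroup_sol qQ) ntQ sQG nQH) subsetI sQG normG.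
by case/negP: ntQ; rewrite -subG1 -(coprime_TIg coLH) subsetI sQL sQH.
Qed.

(** * Commutator condition and solubilizers *)

(** Commutators of generators commute with all generators, so they are central; modulo the centre
    the generators commute. *)
Lemma gen_class2 (gT : finGroupType) (S : {set gT}) :
    (forall u1 u2 u3, u1 \in S -> u2 \in S -> u3 \in S -> [~ u1, u2, u3] = 1) ->
  nil_class <<S>> <= 2.
Proof.
move=> comS3; rewrite nil_class2.
have sRZ : [~: S, S] \subset 'Z(<<S>>).
  rewrite gen_subG; apply/subsetP=> _ /imset2P[u1 u2 Su1 Su2 ->].
  rewrite inE groupR ?mem_gen //= cent_gen; apply/centP=> u3 Su3.
  exact/commgP/eqP/comS3.
rewrite der1_min ?gFnorm // quotient_gen ?abelian_gen.
  by rewrite /abelian quotient_cents2r.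
by rewrite -gen_subG gFnorm.
Qed.

Lemma mem_solubilizer (gT : finGroupType) (G : {group gT}) (x : gT) :
  x \in G -> x \in solubilizer G x.
Proof. by move=> Gx; rewrite inE Gx setUid abelian_sol ?cycle_abelian. Qed.

Lemma solubilizerS (gT : finGroupType) (H G : {group gT}) (x : gT) :
  H \subset G -> solubilizer H x \subset solubilizer G x.
Proof. by move=> sHG; rewrite /solubilizer !setIdE setSI. Qed.

Lemma solubilizer_sol (gT : finGroupType) (G : {group gT}) (x : gT) :
  solvable G -> x \in G -> solubilizer G x = G.
Proof.
move=> solG Gx; apply/setP=> y; rewrite inE andb_idr // => Gy.
by rewrite (solvableS _ solG) // gen_subG subUset !sub1set Gx.
Qed.

Theorem theoremA (gT : finGroupType) (G : {group gT}) :
  (nilpotent G /\ (nil_class G <= 2)%N) <->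
  (exists x : gT, x \in G /\
     forall u1 u2 u3 : gT,
       u1 \in solubilizer G x -> u2 \in solubilizer G x ->
       u3 \in solubilizer G x ->
       [~ u1, u2, u3] = 1).
Proof.
split=> [[nilG clG] | [x [Gx]]].
  (* Any element of G would do, since all triple commutators in G vanish. *)
  exists 1; split=> // u1 u2 u3 /setIdP[Gu1 _] /setIdP[Gu2 _] /setIdP[Gu3 _].
  apply/set1gP; rewrite -(elimT (lcn_nil_classP 2 nilG) clG).
  by rewrite !mem_commg.
suff clG2 : (forall u1 u2 u3 : gT,
       u1 \in solubilizer G x -> u2 \in solubilizer G x ->
       u3 \in solubilizer G x -> [~ u1, u2, u3] = 1) -> nil_class G <= 2.
  by move=> /clG2 clG; split=> //; apply: small_nil_class (leq_trans clG _).
have [n] := ubnP #|G|; elim: n G Gx => // n IHn G Gx /ltnSE leGn comS3.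
have clS := gen_class2 _ _ comS3.
have sSG : <<solubilizer G x>> \subset G.
  by rewrite gen_subG; apply/subsetP=> y /setIdP[].
have [<- // | [M maxM sSM]] := maximal_exists sSG.
have /maxgroupp prMG := maxM; have sMG := proper_sub prMG.
have Mx : x \in M by rewrite (subsetP sSM) ?mem_gen ?mem_solubilizer.
have clM : nil_class M <= 2.
  apply: IHn => //; first exact: leq_trans (proper_card prMG) leGn.
  by move=> u1 u2 u3 *; apply: comS3; apply: (subsetP (solubilizerS _ _ _ _ sMG)).
have solG := maximal_class2_solvable _ _ _ maxM clM.
by rewrite -(genGid G) -(solubilizer_sol _ _ x solG Gx).
Qed.
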